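(* $\displaystyle\lim_{n \to \infty} \frac{\delta_n(S_c,\mathfrak{C})}{n} = 1$, where $\delta_n(S_c,\mathfrak{C})=\max\{d_T(S_c,\mathfrak{C}) : T \text{ is a tree on } n \text{ vertices}\}$.
   Context: For a tree $T$ and $u,v\in V(T)$, $d_T(u,v)$ is the number of edges of the $u$-$v$ path; for $X,Y\subseteq V(T)$, $d(X,Y)=\min\{d_T(x,y): x\in X, y\in Y\}$. For $v\in V(T)$, $f_T(v)$ is the number of subtrees (connected subgraphs) of $T$ containing $v$, and the subtree core $S_c(T)$ is the set of vertices maximizing $f_T(v)$. For $u,v\in V(T)$, $f_T(v,u)$ is the number of subtrees of $T$ containing both $v$ and $u$. The eccentric subtree number of $v$ is $\epsilon_T(v)=\min\{f_T(v,u):u\in V(T)\}$, and the core center $\mathfrak{C}(T)$ is the set of vertices maximizing $\epsilon_T$. Write $d_T(S_c,\mathfrak{C})=d(S_c(T),\mathfrak{C}(T))$. *)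

(* Defs.v *)
From mathcomp Require Import all_boot all_order.
From mathcomp Require Import boolp classical_sets.

Set Implicit Arguments.
Unset Strict Implicit.
Unset Printing Implicit Defensive.

Section Graphs.
Variable V : finType.
Implicit Types (W X Y : {set V}) (E T : {set V * V}) (u v : V).

(* An undirected edge {x, y} is encoded by both ordered pairs (x, y), (y, x). *)
Definition adj E : rel V := [rel x y | (x, y) \in E].

Definition is_graph W E : bool :=
  [forall x, forall y, adj E x y ==>
     [&& x \in W, y \in W, x != y & adj E y x]].

Definition connected_graph W E : bool :=
  [&& is_graph W E, W != finset.set0
    & [forall x in W, forall y in W, connect (adj E) x y]].

(* Cycles have at least three vertices: [:: x; y] satisfies ucycle as soon as
   x and y are adjacent. *)
Definition acyclic E : Prop :=
  forall c : seq V, ucycle (adj E) c -> size c <= 2.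

(* A tree is given by its edge set, its vertex set being the whole of V. *)
Definition is_tree T : Prop := connected_graph [set: V] T /\ acyclic T.

Definition is_path_between T u v (p : seq V) : bool :=
  [&& path (adj T) u p, last u p == v & uniq (u :: p)].

(* The path u :: p has size p edges. In a tree there is exactly one such p, so
   the choice made by xget is immaterial. *)
Definition dist T u v : nat :=
  size (xget [::] (is_path_between T u v : set (seq V))).

(* #|V| exceeds all distances: as a neutral value it does not affect the
   minimum when X and Y are nonempty. *)
Definition set_dist T X Y : nat :=
  \big[Order.min/#|V|]_(p : V * V | (p.1 \in X) && (p.2 \in Y)) dist T p.1 p.2.

(* Subgraphs are pairs (vertex set, edge set). *)
Definition is_subtree T (H : {set V} * {set V * V}) : bool :=
  (H.2 \subset T) && connected_graph H.1 H.2.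

Definition nb_subtrees T v : nat :=
  #|[set H | is_subtree T H & v \in H.1]|.

Definition nb_subtrees2 T v u : nat :=
  #|[set H | is_subtree T H & (v \in H.1) && (u \in H.1)]|.

Definition subtree_core T : {set V} :=
  [set v | [forall u, nb_subtrees T u <= nb_subtrees T v]].

Definition ecc_subtree_number T v : nat :=
  \big[Order.min/nb_subtrees2 T v v]_(u : V) nb_subtrees2 T v u.

Definition core_center T : {set V} :=
  [set v | [forall u, ecc_subtree_number T u <= ecc_subtree_number T v]].

End Graphs.

Definition delta_core (n : nat) : nat :=
  \max_(T : {set 'I_n * 'I_n} | `[< is_tree T >])
     set_dist T (subtree_core T) (core_center T).

(* Main.v *)
Require Import Defs.
From mathcomp Require Import all_boot all_order all_algebra.
From mathcomp Require Import all_classical all_reals all_analysis.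
From mathcomp Require Import zify.
Import Order.TTheory GRing.Theory Num.Theory.
Import mathcomp.boot.fintype mathcomp.boot.finset.

(** The bound [delta_core n <= n] is immediate, since distances in a tree are
smaller than its number of vertices.  The content is a family of trees in which
the subtree core and the core center lie almost [n] apart.

Take a broom: a path (the spine) with vertices [0, ..., m], and [k = n - m]
leaves hanging from the hub [0], on [n + 1] vertices in all, with
[(n + 1)^2 < 2^k], for which a logarithmic [k] suffices.

- The [2^k] sets formed by the hub and some leaves are subtrees through the hub
  that avoid a given spine vertex [j > 0].  Subtrees through [j] that avoid the
  hub are intervals of the spine, of which there are at most [(n + 1)^2].
  Hence [j] is not in the subtree core, which is confined to the hub and its
  leaves ([nb_subtrees_spine], [subtree_core_end]).

- Let [t = m - 3].  About [2^k] subtrees contain the tip [m]: those through the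
  hub are the whole spine and some leaves, the others are intervals
  ([nb_subtrees_tip]).  But at least [2^(k+1)] subtrees contain both [t]
  and a given vertex outside [t, ..., m], because one may stop at each of
  [m - 3, ..., m] and pick all leaves but one freely ([nb_subtrees2_far]).  So
  the eccentric subtree number of [t] is limited by the tip.  A vertex
  outside [t, ..., m] shares strictly fewer subtrees with the tip than [t] does
  ([nb_subtrees2_tip]), hence has a smaller eccentric subtree number: the core
  center is contained in [t, ..., m] ([core_center_spine]).

The distance is thus at least [m - 3] ([broom_set_dist]), and
[k = 2 * up_log 2 (n + 1) + 1] is allowed, which is [o(n)].

To count, a subtree of a tree is identified with its vertex set
([card_subtrees]).  The vertex sets are then controlled by a cut argument: a
subtree that meets both a set and its complement uses an edge between the two
([subtree_crosses]), and the relevant sets of the broom have only one such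
edge. *)

Set Implicit Arguments.
Unset Strict Implicit.
Unset Printing Implicit Defensive.

(** * Subtrees and distances in a tree *)

Section Subtrees.
Variable V : finType.
Implicit Types (W D X Y : {set V}) (E T : {set V * V}) (u v x y : V).

Definition induced T W : {set V * V} :=
  [set e in T | (e.1 \in W) && (e.2 \in W)].

Definition spans_subtree T W : bool := connected_graph W (induced T W).

Lemma adj_induced T W x y :
  adj (induced T W) x y = [&& adj T x y, x \in W & y \in W].
Proof. by rewrite /adj /= inE. Qed.

Lemma is_graph_induced T W : is_graph [set: V] T -> is_graph W (induced T W).
Proof.
move=> /forallP gT; apply/forallP=> x; apply/forallP=> y; apply/implyP.
rewrite !adj_induced => /and3P[Txy -> ->].
by have /forallP/(_ y)/implyP/(_ Txy)/and4P[_ _ -> ->] := gT x.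
Qed.

(** If an edge of [T] joining two vertices of a subtree were missing from the
subtree, a path of the subtree between its ends would close up to a cycle. *)
Lemma acyclic_subtree_edges T W E : acyclic T -> is_subtree T (W, E) ->
  is_graph [set: V] T -> E = induced T W.
Proof.
move=> acT /andP[/= sET /and3P[gE _ /forall_inP cE]] gT.
apply/setP=> -[x y]; rewrite !inE /=; apply/idP/idP.
  move=> Exy; rewrite (subsetP sET _ Exy) /=.
  by have /forallP/(_ x)/forallP/(_ y)/implyP/(_ Exy)/and4P[-> ->] := gE.
case/and3P=> Txy xW yW.
have /forallP/(_ x)/forallP/(_ y)/implyP/(_ Txy)/and4P[_ _ nxy Tyx] := gT.
have /forall_inP/(_ y yW)/connectP[p0 p0P lp0] := cE x xW.
move: lp0; case/shortenP: p0P => p pE up _ yp.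
have : size (x :: p) <= 2.
  apply: acT; rewrite /ucycle up andbT /= rcons_path -yp Tyx andbT.
  by apply: sub_path pE => a b; apply: (subsetP sET).
case: p pE {up} yp => [|z [|//]] /=.
  by move=> _ yx; rewrite yx eqxx in nxy.
by rewrite andbT => Exz -> .
Qed.

Lemma card_subtrees T (P : pred {set V}) : acyclic T -> is_graph [set: V] T ->
  #|[set H | is_subtree T H & P H.1]| = #|[set W | spans_subtree T W & P W]|.
Proof.
move=> acT gT; rewrite -(card_in_imset (f := fst)); last first.
  move=> [W E] [W' E']; rewrite !inE /= => /andP[sH _] /andP[sH' _] eW.
  rewrite -eW in sH' *.
  by rewrite (acyclic_subtree_edges acT sH gT)
    (acyclic_subtree_edges acT sH' gT).
apply: eq_card => W; rewrite inE; apply/imsetP/andP.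
  case=> -[W' E]; rewrite inE /= => /andP[sH PW] ->; split=> //.
  rewrite /spans_subtree -(acyclic_subtree_edges acT sH gT).
  by case/andP: sH.
case=> sW PW; exists (W, induced T W); rewrite // inE /= PW andbT.
rewrite /is_subtree [connected_graph _ _]sW andbT.
by apply/subsetP=> e; rewrite inE => /andP[].
Qed.

(** The cut argument through which all convexity properties below are obtained. *)
Lemma subtree_crosses T W D x y : spans_subtree T W ->
  x \in W -> x \in D -> y \in W -> y \notin D ->
  exists a b, [/\ adj T a b, a \in W, b \in W, a \in D & b \notin D].
Proof.
move=> /and3P[_ _ /forall_inP cW] xW xD yW yD.
have /forall_inP/(_ y yW)/connectP[p pP py] := cW x xW.
elim: p x {xW} xD pP py => [|z p IHp] x xD /= => [_ yx|/andP[xz pz] py].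
  by rewrite yx xD in yD.
case: (boolP (z \in D)) => zD; first exact: (IHp z).
by move: xz; rewrite adj_induced => /and3P[Txz xW zW]; exists x, z; split.
Qed.

(** Descending along the rank [h] leads from every vertex to the root [r]
without leaving [W]. *)
Lemma rooted_subtree T W r (h : V -> nat) : is_graph [set: V] T ->
  r \in W ->
  (forall x, x \in W -> x != r ->
     exists y, [/\ adj T x y, y \in W & h y < h x]) ->
  spans_subtree T W.
Proof.
move=> gT rW step; have gW := is_graph_induced W gT.
have symW : connect_sym (adj (induced T W)).
  apply: sym_connect_sym => x y; apply/idP/idP.
    by move=> a; have /forallP/(_ x)/forallP/(_ y)/implyP/(_ a)/and4P[] := gW.
  by move=> a; have /forallP/(_ y)/forallP/(_ x)/implyP/(_ a)/and4P[] := gW.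
have toroot x : x \in W -> connect (adj (induced T W)) x r.
  have [n] := ubnP (h x); elim: n x => // n IHn x ltxn xW.
  have [-> //|xr] := eqVneq x r.
  have [y [Txy yW ltyx]] := step x xW xr.
  apply: connect_trans (connect1 _) (IHn y _ yW); last exact: leq_trans ltyx _.
  by rewrite adj_induced Txy xW.
apply/and3P; split=> //; first by apply/set0Pn; exists r.
apply/forall_inP=> x xW; apply/forall_inP=> y yW.
by apply: connect_trans (toroot x xW) _; rewrite symW toroot.
Qed.

Lemma dist_path T u v : is_tree T -> is_path_between T u v
   (xget [::] (is_path_between T u v : set (seq V))).
Proof.
case=> /and3P[_ _ /forall_inP cT] _.
have /forall_inP/(_ v (in_setT v))/connectP[p0 p0P lp0] := cT u (in_setT u).
move: lp0; case/shortenP: p0P => p pT up _ vp.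
by apply: (@xgetPex _ [::] (is_path_between T u v : set (seq V))); exists p;
  rewrite /is_path_between pT -vp eqxx.
Qed.

(** Gives lower bounds on distances without identifying the path that realizes
them. *)
Lemma dist_lipschitz T u v (h : V -> nat) : is_tree T ->
  (forall x y, adj T x y -> h y <= (h x).+1) -> h v <= h u + dist T u v.
Proof.
move=> /(@dist_path T u v) + hT; rewrite /dist.
move: (xget _ _) => p /and3P[pT /eqP <- _].
elim: p u pT => [|z p IHp] u /=; first by rewrite addn0.
case/andP=> /hT huz /IHp le_p; rewrite addnS -addSn.
by apply: leq_trans le_p _; rewrite leq_add2r.
Qed.

Lemma set_dist_le T X Y : set_dist T X Y <= #|V|.
Proof. by rewrite /set_dist -leEnat bigmin_le_id. Qed.

Lemma set_dist_ge T X Y d : d <= #|V| ->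
  (forall x y, x \in X -> y \in Y -> d <= dist T x y) -> d <= set_dist T X Y.
Proof.
move=> dV dXY; rewrite /set_dist -leEnat; apply: le_bigmin => // -[x y] /=.
by case/andP; exact: dXY.
Qed.

End Subtrees.

(** * Brooms *)

Section Broom.
Variables n m : nat.
Implicit Types (x y l j t u v z : 'I_n.+1) (W A : {set 'I_n.+1}).

(** The tree is rooted at the hub [0]: the spine is [0, ..., m], and the
vertices above [m] are leaves attached to the hub.  Parents have smaller indices. *)
Definition parent (i : nat) : nat := if i <= m then i.-1 else 0.
Definition child (i j : nat) : bool := (0 < j) && (i == parent j).

Definition broom : {set 'I_n.+1 * 'I_n.+1} :=
  [set e : 'I_n.+1 * 'I_n.+1 | child e.1 e.2 || child e.2 e.1].

Lemma adj_broom x y : adj broom x y = child x y || child y x.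
Proof. by rewrite /adj /= inE. Qed.

Lemma child_lt i j : child i j -> i < j.
Proof. by rewrite /child /parent; case: ifP; lia. Qed.

Lemma broom_graph : is_graph [set: 'I_n.+1] broom.
Proof.
apply/forallP=> x; apply/forallP=> y; apply/implyP; rewrite !inE !adj_broom.
by rewrite orbC => xy; rewrite xy andbT /= -val_eqE /=;
  case/orP: xy => /child_lt; rewrite ltn_neqAle => /andP[]; rewrite // eq_sym.
Qed.

Lemma has_parent x : x != ord0 -> exists y, child y x.
Proof.
move=> x0; have x_gt0 : 0 < x by rewrite lt0n.
have px : parent x < n.+1.
  by apply: ltn_trans (ltn_ord x); apply: child_lt; rewrite /child x_gt0 eqxx.
by exists (Ordinal px); rewrite /child x_gt0 eqxx.
Qed.

(** The two neighbours in a cycle of its largest vertex would both be the parent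
of that vertex. *)
Lemma broom_acyclic : acyclic broom.
Proof.
move=> c /andP[cyc uc]; rewrite leqNgt; apply/negP=> sz.
have [x0 x0c] : exists x, x \in c.
  by case: c sz {cyc uc} => // x c; exists x; rewrite mem_head.
have [x xc xmax] := @arg_maxnP _ x0 [in c] (fun x => x : nat) x0c.
have [i c' cE] := rot_to xc.
have : ucycle (adj broom) (x :: c').
  by rewrite /ucycle -cE rot_cycle cyc rot_uniq.
have {xmax} xmax y : y \in c' -> y <= x.
  by move=> yc; apply: xmax; rewrite -(mem_rot i) cE in_cons yc orbT.
have {sz} : 1 < size c' by move: sz; rewrite -(size_rot i) cE.
have low y : y \in c' -> child x y || child y x -> (y : nat) = parent x.
  move=> /xmax yx /orP[/child_lt|/andP[_ /eqP //]].
  by rewrite ltnNge yx.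
case: c' low {cE xmax} => [|y [|z p]] // low _ /andP[/= /and3P[xy _]].
rewrite rcons_path => /andP[_ lx] /and3P[_ + _].
have ey := low y (mem_head _ _); rewrite -adj_broom in ey.
have {}ey := ey xy.
have lc : last z p \in [:: y, z & p] by rewrite inE mem_last orbT.
have el : (last z p : nat) = parent x.
  by apply: low lc _; move: lx; rewrite /= adj_broom orbC.
have -> : y = last z p by apply: val_inj; rewrite /= ey el.
by rewrite mem_last.
Qed.

Lemma parent_closed_spans W r : r \in W ->
  (forall x, x \in W -> x != r -> exists2 y, y \in W & child y x) ->
  spans_subtree broom W.
Proof.
move=> rW cl; apply: (rooted_subtree (h := val) broom_graph rW) => x xW xr.
have [y yW yx] := cl x xW xr; exists y; split=> //; last exact: child_lt.
by rewrite adj_broom yx orbT.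
Qed.

Lemma broom_tree : is_tree broom.
Proof.
split; last exact: broom_acyclic.
have -> : broom = induced broom [set: 'I_n.+1].
  by apply/setP=> e; rewrite !inE !andbT.
apply: (@parent_closed_spans _ ord0); first by rewrite inE.
by move=> x _ /has_parent[y yx]; exists y; rewrite ?inE.
Qed.

Definition leaves : {set 'I_n.+1} := [set l : 'I_n.+1 | m < l].

Definition segment (a b : nat) : {set 'I_n.+1} :=
  [set x : 'I_n.+1 | a <= x <= b].

Definition bristled b A := segment 0 b :|: A.

Lemma card_leaves : #|leaves| = n - m.
Proof.
rewrite /leaves -sum1dep_card -(big_mkord (fun i => m < i) (fun=> 1)).
have [mn|nm] := leqP m n; last first.
  rewrite big_nat_cond big_pred0 => [|i]; last by lia.
  by apply/esym/eqP; rewrite subn_eq0 ltnW.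
rewrite (big_cat_nat (n := m.+1)) //= big_nat_cond big_pred0 => [|i]; last by lia.
rewrite big_nat_cond (eq_bigl (fun i => (m.+1 <= i < n.+1) && true)) => [|i].
  by rewrite -big_nat_cond sum_nat_const_nat muln1 add0n subSS.
by lia.
Qed.

Lemma segment_spans a b : a <= b <= m -> b <= n ->
  spans_subtree broom (segment a b).
Proof.
move=> /andP[ab bm] bn; have an : a < n.+1 by rewrite ltnS (leq_trans ab).
apply: (@parent_closed_spans _ (Ordinal an)); first by rewrite inE /= leqnn.
move=> x; rewrite inE => /andP[ax xb]; rewrite -val_eqE /= => xa.
have x0 : x != ord0 by rewrite -val_eqE /=; lia.
have [y yx] := has_parent x0; have ltyx := child_lt yx; exists y; rewrite // inE.
by move: yx; rewrite /child /parent; case: ifP; lia.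
Qed.

Lemma bristled_spans b A : b <= m -> A \subset leaves ->
  spans_subtree broom (bristled b A).
Proof.
move=> bm /subsetP sA; apply: (@parent_closed_spans _ ord0).
  by rewrite !inE.
move=> x; rewrite !inE => xW x0.
have [y yx] := has_parent x0; have ltyx := child_lt yx; exists y; rewrite // !inE.
case/orP: xW => [xb|/sA]; last rewrite inE; move: yx; rewrite /child /parent.
  by case: ifP; lia.
by case: ifP; lia.
Qed.

(** The only edge of the broom leaving [segment i m] joins [i] to its parent. *)
Lemma subtree_gate W (i b y : 'I_n.+1) :
  spans_subtree broom W -> 0 < i -> i <= b <= m ->
  b \in W -> y \in W -> ~~ (i <= y <= m) -> i \in W.
Proof.
move=> sW i0 ibm bW yW yi.
have [||x [z [xz xW zW]]] := subtree_crosses (D := segment i m) sW bW _ yW.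
- by rewrite inE.
- by rewrite inE.
rewrite !inE => xi zi; suff -> : i = x by [].
apply: val_inj => /=; move: xz; rewrite adj_broom /child /parent.
by case: ifP; case: ifP; lia.
Qed.

(** The only edge at a leaf leads to the hub. *)
Lemma subtree_hub W l y : spans_subtree broom W -> m < l -> l \in W ->
  y \in W -> y != l -> ord0 \in W.
Proof.
move=> sW ml lW yW yl.
have [||x [z [xz xW zW]]] := subtree_crosses (D := [set l]) sW lW _ yW.
- by rewrite inE.
- by rewrite inE.
rewrite !inE => /eqP xl zl; suff -> : ord0 = z by [].
apply: val_inj => /=; move: xz; rewrite xl adj_broom /child /parent.
by case: ifP; case: ifP; lia.
Qed.

Lemma subtree_avoiding_hub W j : spans_subtree broom W -> ord0 \notin W ->
  j \in W -> j <= m ->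
  exists a b : 'I_n.+1, [/\ b \in W, b <= m & W = segment a b].
Proof.
move=> sW hW jW jm.
have Wm x : x \in W -> x <= m.
  move=> xW; rewrite leqNgt; apply: contra hW => mx.
  by apply: (subtree_hub sW mx xW jW); apply: contraTneq mx => <-; rewrite -leqNgt.
have [a aW mina] := @arg_minnP _ j [in W] (fun x => x : nat) jW.
have [b bW maxb] := @arg_maxnP _ j [in W] (fun x => x : nat) jW.
exists a, b; split=> //; first exact: Wm.
apply/setP=> x; rewrite inE; apply/idP/andP => [xW|[ax xb]].
  by split; [apply: mina|apply: maxb].
have [->//|xa] := eqVneq x a.
have ltax : a < x by rewrite ltn_neqAle ax eq_sym xa.
apply: (subtree_gate sW _ _ bW aW); last by rewrite leqNgt ltax.
  exact: leq_ltn_trans ltax.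
by rewrite xb Wm.
Qed.

Lemma nb_subtreesE v :
  nb_subtrees broom v = #|[set W | spans_subtree broom W & v \in W]|.
Proof.
exact: (card_subtrees (fun W => v \in W) broom_acyclic broom_graph).
Qed.

Lemma nb_subtrees2E v u : nb_subtrees2 broom v u =
  #|[set W | spans_subtree broom W & (v \in W) && (u \in W)]|.
Proof.
exact: (card_subtrees (fun W => (v \in W) && (u \in W)) broom_acyclic broom_graph).
Qed.

(** * Where the subtree core and the core center of a broom lie *)

Hypothesis many_leaves : n.+1 ^ 2 < 2 ^ (n - m).

(** Subtrees containing both vertices cancel out.  Those containing only [j] are
intervals, hence at most [n.+1 ^ 2]; those containing only the hub include the
hub with any set of leaves. *)
Lemma nb_subtrees_spine j : 0 < j <= m ->
  nb_subtrees broom j < nb_subtrees broom ord0.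
Proof.
case/andP=> j0 jm; rewrite !nb_subtreesE.
set S := fun v => [set W | spans_subtree broom W & v \in W].
rewrite -/(S j) -/(S ord0) -(cardsID (S ord0) (S j)) -(cardsID (S j) (S ord0)).
rewrite setIC ltn_add2l.
apply: (@leq_ltn_trans (n.+1 ^ 2)); last apply: (leq_trans many_leaves).
  have -> : n.+1 ^ 2 = #|[set: 'I_n.+1 * 'I_n.+1]|.
    by rewrite cardsT card_prod card_ord.
  pose seg (p : 'I_n.+1 * 'I_n.+1) := segment p.1 p.2.
  apply: leq_trans (leq_imset_card seg _).
  apply: subset_leq_card; apply/subsetP=> W; rewrite !inE => /andP[+ /andP[sW jW]].
  rewrite sW /= => hW; have [a [b [_ _ ->]]] := subtree_avoiding_hub sW hW jW jm.
  by apply/imsetP; exists (a, b); rewrite ?inE.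
rewrite -card_leaves -card_powerset -(card_in_imset (f := bristled 0)).
  apply: subset_leq_card; apply/subsetP=> _ /imsetP[A + ->].
  rewrite inE => sA; rewrite !inE (bristled_spans _ sA) //= andbT.
  rewrite leqn0 negb_or -lt0n j0 /=.
  by apply: contraTN jm => /(subsetP sA); rewrite inE -ltnNge.
move=> A A'; rewrite !inE => /subsetP sA /subsetP sA' /setP eAA'.
apply/setP=> x; have := eAA' x; rewrite !inE /= leqn0.
have [x0 _|//] := eqVneq (x : nat) 0.
have xl : x \notin leaves by rewrite inE x0.
by rewrite (contraNF (sA x) xl) (contraNF (sA' x) xl).
Qed.

(** A subtree containing the tip is determined by its leaves if it contains the
hub, and by its lowest vertex otherwise. *)
Lemma nb_subtrees_tip z : z = m :> nat ->
  nb_subtrees broom z <= 2 ^ (n - m) + n.+1.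
Proof.
move=> zm; rewrite nb_subtreesE -card_leaves -card_powerset.
rewrite -[X in _ <= _ + X]card_ord -cardsT.
apply: leq_trans (leq_add (leq_imset_card (bristled m) _)
  (leq_imset_card (fun a : 'I_n.+1 => segment a m) _)).
apply: leq_trans (leq_card_setU _ _).
apply: subset_leq_card; apply/subsetP=> W; rewrite 2!inE => /andP[sW zW].
have [hW|hW] := boolP (ord0 \in W); apply/orP; [left|right]; last first.
  have [|a [b [bW bm eW]]] := subtree_avoiding_hub sW hW zW; first by rewrite zm.
  apply/imsetP; exists a; rewrite ?inE //; suff <- : b = m :> nat by [].
  by move: zW; rewrite eW inE zm; lia.
apply/imsetP; exists (W :&: leaves); first by rewrite inE subsetIr.
apply/setP=> x; rewrite !inE; have [xm|xm] := leqP x m; last by rewrite andbT.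
have [->|x0] := eqVneq x ord0; first exact: hW.
apply: (subtree_gate sW _ _ zW hW); rewrite ?zm ?leqnn ?xm ?lt0n //.
by rewrite leqn0 negb_and x0.
Qed.

(** A subtree may start from a fixed leaf [l], stop at any of the four last spine
vertices and contain any of the [n - m - 1] other leaves.  With [l] equal to [u]
when [u] is a leaf, all these subtrees contain [u]. *)
Lemma nb_subtrees2_far t u : 3 <= m -> t = m - 3 :> nat -> ~~ (t <= u <= m) ->
  2 ^ (n - m) + 2 ^ (n - m) <= nb_subtrees2 broom t u.
Proof.
move=> m3 tm uP; rewrite nb_subtrees2E.
have k0 : 0 < n - m by case: (n - m) many_leaves; lia.
pose l := if m < u then u else ord_max.
have ml : m < l by rewrite /l; case: ifP => //=; lia.
have ll : l \in leaves by rewrite inE.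
pose g (p : {set 'I_n.+1} * 'I_4) := bristled (m - p.2) (l |: p.1).
have cardX : 2 ^ (n - m) + 2 ^ (n - m) =
    #|setX (powerset (leaves :\ l)) [set: 'I_4]|.
  rewrite cardsX card_powerset cardsT card_ord.
  have := cardsD1 l leaves; rewrite ll card_leaves => ->.
  rewrite add1n expnS; move: (2 ^ _) => c; lia.
rewrite cardX -(card_in_imset (f := g)).
  apply: subset_leq_card; apply/subsetP=> _ /imsetP[[A i] + ->].
  rewrite in_setX inE /= => /andP[sA _]; rewrite inE; apply/andP; split.
    apply: bristled_spans; first exact: leq_subr.
    by rewrite subUset sub1set ll (subset_trans sA) // subD1set.
  rewrite /g /= !inE; apply/andP; split; first by have := ltn_ord i; lia.
  rewrite /l; case: ifP => um; first by rewrite eqxx orbT.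
  by apply/orP; left; have := ltn_ord i; lia.
(* The last spine vertex of [g (A, i)] determines [i]. *)
have sub A A' (i i' : 'I_4) : A' \subset leaves :\ l ->
    g (A, i) \subset g (A', i') -> m - i <= m - i'.
  move=> sA' sg; have mi : m - i < n.+1 by lia.
  have /(subsetP sg) : Ordinal mi \in g (A, i) by rewrite !inE /= leqnn.
  rewrite !inE /= => /or3P[//|/eqP e|/(subsetP sA')].
    by move: ml; rewrite -e /=; lia.
  by rewrite !inE /=; lia.
move=> [A i] [A' i']; rewrite !in_setX !inE /= => /andP[sA _] /andP[sA' _] eg.
have gA (B : {set _}) (i0 : 'I_4) : B \subset leaves :\ l ->
    g (B, i0) :&: (leaves :\ l) = B.
  move=> /subsetP sB; apply/setP=> x; rewrite !inE /=.
  have [xB|xB] := boolP (x \in B).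
    by rewrite !orbT; have := sB x xB; rewrite !inE => ->.
  rewrite orbF; case: (x == l); rewrite ?andbF //= orbF.
  by have := ltn_ord i0; lia.
have eA : A = A' by rewrite -(gA A i sA) -(gA A' i' sA') eg.
have := sub A A' i i' sA'; have := sub A' A i' i sA.
rewrite eg subxx => /(_ isT) le1 /(_ isT) le2.
congr (_, _) => //; apply: val_inj => /=.
by have := ltn_ord i; have := ltn_ord i'; lia.
Qed.

(** Since [x] lies outside, a subtree containing [x] and the tip must enter the
end of the spine through [t]; the interval from [t] to
the tip makes the inequality strict. *)
Lemma nb_subtrees2_tip t z x : t = m - 3 :> nat -> z = m :> nat ->
  0 < t -> ~~ (t <= x <= m) -> nb_subtrees2 broom x z < nb_subtrees2 broom t z.
Proof.
move=> tm zm t0 xP; rewrite !nb_subtrees2E.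
apply: proper_card; apply/properP; split.
  apply/subsetP=> W; rewrite !inE => /and3P[sW xW zW].
  rewrite sW zW andbT /= (subtree_gate sW t0 _ zW xW xP) //.
  by rewrite zm leqnn tm leq_subr.
have zn := ltn_ord z.
exists (segment t z); last by rewrite !inE zm (negPf xP) andbF.
rewrite !inE !leqnn !zm andbT segment_spans ?tm ?leq_subr ?leqnn //; lia.
Qed.

Lemma core_center_spine x : 3 < m -> x \in core_center broom -> m - 3 <= x <= m.
Proof.
move=> m3; apply: contraLR => xP; rewrite inE; apply/forallPn.
have mn : m < n by have := many_leaves; case: (ltnP m n) => // /eqP ->; lia.
have tn : m - 3 < n.+1 by lia.
have zn : m < n.+1 by lia.
exists (Ordinal tn); rewrite -ltnNge.
set t := Ordinal tn; set z := Ordinal zn.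
have ltz : nb_subtrees2 broom x z < nb_subtrees2 broom t z.
  by apply: nb_subtrees2_tip => //=; lia.
suff lt u : nb_subtrees2 broom x z < nb_subtrees2 broom t u.
  apply: (@leq_ltn_trans (nb_subtrees2 broom x z)).
    by rewrite /ecc_subtree_number -leEnat; apply: bigmin_le.
  by rewrite /ecc_subtree_number -leEnat; apply: le_bigmin => [|u _];
    rewrite leEnat.
have [uP|uP] := boolP (t <= u <= m).
  (* Subtrees containing [t] and the tip also contain [u], which lies between. *)
  apply: (leq_trans ltz); rewrite !nb_subtrees2E; apply: subset_leq_card.
  apply/subsetP=> W; rewrite !inE => /and3P[sW tW zW]; rewrite sW tW /=.
  have [->//|ut] := eqVneq u t.
  have {}ut : t < u by move: ut;
    rewrite ltn_neqAle eq_sym -val_eqE => ->; case/andP: uP.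
  by apply: (subtree_gate sW _ _ zW tW) => /=; rewrite /= in ut uP *; lia.
(* Every vertex shares fewer subtrees with the tip than [t] and [u] share. *)
apply: leq_trans (nb_subtrees2_far _ _ uP) => //; last by lia.
apply: (@leq_ltn_trans (nb_subtrees broom z)).
  rewrite nb_subtreesE nb_subtrees2E; apply: subset_leq_card.
  by apply/subsetP=> W; rewrite !inE => /and3P[-> _ ->].
apply: leq_ltn_trans (nb_subtrees_tip _) _ => //; rewrite ltn_add2l.
by apply: leq_ltn_trans many_leaves; rewrite -{1}(expn1 n.+1) leq_pexp2l.
Qed.

Lemma subtree_core_end x : x \in subtree_core broom -> x = ord0 \/ m < x.
Proof.
rewrite inE => /forallP/(_ ord0); have [->|x0] := eqVneq x ord0; first by left.
have [xm|mx] := leqP x m; last by right.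
by rewrite leqNgt nb_subtrees_spine // lt0n x0.
Qed.

Lemma broom_set_dist :
  m - 3 <= set_dist broom (subtree_core broom) (core_center broom).
Proof.
have [m3|m3] := leqP m 3; first by have -> : m - 3 = 0 by lia.
apply: set_dist_ge => [|x y xS yC].
  rewrite card_ord; have := many_leaves.
  by case: (leqP m n) => [|/ltnW/eqP ->]; lia.
(* The distance to the hub, up to the leaves, which are sent to [0] so that [h]
   vanishes on the whole subtree core. *)
pose h (i : 'I_n.+1) : nat := if i <= m then nat_of_ord i else 0.
have hx : h x = 0.
  by case: (subtree_core_end xS) => [->|mx];
    rewrite /h ?leqn0 /= ?if_same // leqNgt mx.
have /andP[ty ym] := core_center_spine m3 yC.
apply: leq_trans (_ : h y <= _); first by rewrite /h ym.
rewrite -[dist _ _ _]add0n -hx; apply: dist_lipschitz broom_tree _ => a b.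
rewrite adj_broom /h /child /parent.
by case: ifP; case: ifP; lia.
Qed.

End Broom.

(** * The growth of [delta_core] *)

Lemma delta_core_le n : delta_core n <= n.
Proof.
apply/bigmax_leqP=> T _.
by apply: (leq_trans (set_dist_le _ _ _)); rewrite card_ord.
Qed.

Lemma delta_core_ge n : n - ((up_log 2 n).*2 + 5) <= delta_core n.
Proof.
case: n => [//|n]; set K := up_log 2 n.+1.
have [nK|Kn] := leqP n K.*2.
  by rewrite (_ : _ - _ = 0) //; lia.
(* With [K.*2.+1] leaves, [2 ^ K.*2.+1 > n.+1 ^ 2] since [2 ^ K >= n.+1]. *)
pose m := n - K.*2.+1.
have nm : n - m = K.*2.+1 by rewrite /m; lia.
have many : n.+1 ^ 2 < 2 ^ (n - m).
  apply: (@leq_ltn_trans (2 ^ K.*2)); last by rewrite nm ltn_exp2l.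
  by rewrite -muln2 expnM leq_exp2r // up_logP.
apply: leq_trans (leq_bigmax_cond (broom n m) _); last first.
  by apply/asboolP; exact: broom_tree.
apply: leq_trans (broom_set_dist many); rewrite /m; lia.
Qed.

(** An elementary form of the fact that the logarithm is [o(n)]: the deficit in
[delta_core_ge] is at most of order [sqrt n]. *)
Lemma sqr_up_log_le n : 0 < n -> ((up_log 2 n).*2 + 5) ^ 2 <= 50 * n.
Proof.
move=> n0; have quad k : (k.*2 + 5) ^ 2 <= 25 * 2 ^ k.
  rewrite -mulnn; elim: k => // k; rewrite [2 ^ k.+1]expnS.
  by move: (2 ^ k) => p; nia.
apply: (leq_trans (quad _)).
have [n1|n1] := leqP n 1; first by have -> : n = 1 by lia.
have := @up_log_gtn 2 n isT n1; have : 0 < up_log 2 n by rewrite up_log_gt0 n1.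
by case: (up_log 2 n) => // k _ /=; rewrite expnS; lia.
Qed.

Import numFieldNormedType.Exports.
Local Open Scope classical_set_scope.
Local Open Scope ring_scope.

Theorem proposition5p23 (R : realType) :
  ((delta_core n)%:R / n%:R : R) @[n --> \oo] --> (1 : R).
Proof.
(* The deficit [d] satisfies [d ^ 2 <= 50 n], so [d < e n] once [50 < e ^ 2 n]. *)
apply/cvgrPdist_lt => e e0; near=> n.
have n0 : (0 < n)%N by near: n; exact: nbhs_infty_gt.
have nR : 0 < n%:R :> R by rewrite ltr0n.
have ne : 50 < e ^+ 2 * n%:R.
  rewrite -ltr_pdivrMl ?exprn_gt0 //; near: n; exact: nbhs_infty_gtr.
set d := ((up_log 2 n).*2 + 5)%N.
have le1 : (delta_core n)%:R <= n%:R :> R by rewrite ler_nat delta_core_le.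
have ge1 : n%:R <= (delta_core n)%:R + d%:R :> R.
  by rewrite -natrD ler_nat; have := delta_core_ge n; rewrite -/d; lia.
have dn : d%:R < e * n%:R.
  rewrite -(@ltr_pXn2r _ 2) ?nnegrE ?mulr_ge0 // ?ltW //.
  apply: (@le_lt_trans _ _ (50 * n%:R)).
    by rewrite -natrX -natrM ler_nat sqr_up_log_le.
  by rewrite exprMn [n%:R ^+ 2]expr2 mulrA ltr_pM2r.
rewrite -[X in X - _](divff (lt0r_neq0 nR)) -mulrBl ger0_norm; last first.
  by rewrite divr_ge0 // subr_ge0.
by rewrite ltr_pdivrMr // (le_lt_trans _ dn) // lerBlDl.
Unshelve. all: by end_near. Qed.
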